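(* Let $(A,\Delta,\diamond,\circ,\sigma)$ be a Hopf truss over a field $\mathbb{K}$, and let $S$ denote the antipode of $(A,\Delta,\diamond)$. (1) $(A,\diamond)$ is a left module algebra over the (non-unital) bialgebra $(A,\Delta,\circ)$ with any of the actions $$\triangleright: A\otimes A\to A,\quad a\triangleright b = \sum S\sigma(a_{(1)})\diamond(a_{(2)}\circ b),$$ $$\blacktriangleright: A\otimes A\to A,\quad a\blacktriangleright b = \sum (a_{(1)}\circ b)\diamond S\sigma(a_{(2)}).$$ (2) For all $a,b\in A$, $$\sigma(a\circ b) = \sum\sigma(a_{(1)})\diamond(a_{(2)}\triangleright\sigma(b)),\qquad \sigma(a\circ b) = \sum(a_{(1)}\blacktriangleright\sigma(b))\diamond\sigma(a_{(2)}).$$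
   Context: Sweedler notation $\Delta(a) = \sum a_{(1)}\otimes a_{(2)}$ is used. A (left) Hopf truss consists of a coalgebra $(A,\Delta,\varepsilon)$ over a field $\mathbb{K}$, a bilinear operation $\diamond$ making $(A,\Delta,\varepsilon)$ a Hopf algebra with identity $1_\diamond$ and antipode $S$, a bilinear operation $\circ$ making $(A,\Delta,\varepsilon)$ a non-unital bialgebra (i.e. $\circ:A\otimes A\to A$ is an associative morphism of coalgebras), and a coalgebra endomorphism $\sigma$ of $(A,\Delta,\varepsilon)$ such that for all $a,b,c\in A$, $a\circ(b\diamond c) = \sum(a_{(1)}\circ b)\diamond S\sigma(a_{(2)})\diamond(a_{(3)}\circ c)$. That $(A,\diamond)$ is a left module algebra over $(A,\Delta,\circ)$ with action $\triangleright$ means that for all $a,b,c\in A$: $a\triangleright(b\diamond c) = \sum(a_{(1)}\triangleright b)\diamond(a_{(2)}\triangleright c)$, $a\triangleright 1_\diamond = \varepsilon(a)1_\diamond$ and $(a\circ b)\triangleright c = a\triangleright(b\triangleright c)$; similarly for $\blacktriangleright$. *)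

(* Defs.v *)
From HB Require Import structures.
From mathcomp Require Import all_boot all_order all_algebra.
From mathcomp Require Import boolp.
From mathcomp.multinomials Require Import freeg.

Set Implicit Arguments.
Unset Strict Implicit.
Unset Printing Implicit Defensive.
Import GRing.Theory.
Local Open Scope ring_scope.
Local Open Scope quotient_scope.

Reserved Notation "U ⊗ V" (at level 40, left associativity).
Reserved Notation "a ∘ b" (at level 40, left associativity).
Reserved Notation "a ▷ b" (at level 40, left associativity).
Reserved Notation "a ▶ b" (at level 40, left associativity).
Reserved Notation "\sw_ ( x , y <- a ) E"
  (at level 41, x name, y name, a at level 60, E at level 41,
   format "\sw_ ( x ,  y  <-  a )  E").

(* U ⊗ V is the quotient of the free K-module on U * V by the K-span of the
   bilinearity relators. *)
Section TensorDef.
Context {K : fieldType} (U V : lmodType K).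
Local Notation free := {freeg (U * V)%type / K}.

Inductive bilinear_span : free -> Prop :=
| bspan0 : bilinear_span 0
| bspanD s t : bilinear_span s -> bilinear_span t -> bilinear_span (s + t)
| bspanZ k s : bilinear_span s -> bilinear_span (k *: s)
| bspan_addl u u' v :
    bilinear_span (<<(u + u', v)>> - << (u, v) >> - << (u', v) >>)
| bspan_addr u v v' :
    bilinear_span (<<(u, v + v')>> - << (u, v) >> - << (u, v') >>)
| bspan_scalel k u v : bilinear_span (<<(k *: u, v)>> - k *: << (u, v) >>)
| bspan_scaler k u v : bilinear_span (<<(u, k *: v)>> - k *: << (u, v) >>).

Definition bilinear_spanb : {pred free} := fun s => `[< bilinear_span s >].

Lemma bilinear_spanb_closed : zmod_closed bilinear_spanb.
Proof.
split=> [|s t /asboolP hs /asboolP ht]; apply/asboolP; first exact: bspan0.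
by apply: bspanD => //; rewrite -scaleN1r; apply: bspanZ.
Qed.

HB.instance Definition _ :=
  GRing.isZmodClosed.Build free bilinear_spanb bilinear_spanb_closed.

Definition tensor : Type := Quotient.quot bilinear_spanb.

HB.instance Definition _ := GRing.Zmodule.on tensor.

Definition tproj (s : free) : tensor := \pi_(Quotient.quot bilinear_spanb) s.
Definition trepr (t : tensor) : free := repr t.

Lemma treprK t : tproj (trepr t) = t. Proof. exact: reprK. Qed.

Lemma tproj_eq s t : tproj s = tproj t <-> bilinear_span (s - t).
Proof.
split=> [/eqmodP|h]; last apply/eqmodP.
  by rewrite /= Quotient.equivE => /asboolP.
by rewrite /= Quotient.equivE; apply/asboolP.
Qed.

Lemma tprojB : {morph tproj : s t / s - t}.
Proof. by move=> s t; rewrite /tproj raddfB. Qed.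

HB.instance Definition _ := GRing.isZmodMorphism.Build free tensor tproj tprojB.

Definition tscale (k : K) (t : tensor) : tensor := tproj (k *: trepr t).

Lemma tscale_proj k s : tscale k (tproj s) = tproj (k *: s).
Proof.
apply/tproj_eq; rewrite -scalerBr; apply: bspanZ.
by apply/tproj_eq; rewrite treprK.
Qed.

Fact tscaleA k l t : tscale k (tscale l t) = tscale (k * l) t.
Proof. by rewrite -(treprK t) !tscale_proj scalerA. Qed.
Fact tscale1 : left_id 1 tscale.
Proof. by move=> t; rewrite /tscale scale1r treprK. Qed.
Fact tscaleDr : right_distributive tscale +%R.
Proof.
move=> k s t; rewrite -(treprK s) -(treprK t) -raddfD !tscale_proj.
by rewrite scalerDr raddfD.
Qed.
Fact tscaleDl t : {morph tscale^~ t : k l / k + l}.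
Proof. by move=> k l; rewrite -(treprK t) !tscale_proj scalerDl raddfD. Qed.

HB.instance Definition _ := GRing.Zmodule_isLmodule.Build K tensor
  tscaleA tscale1 tscaleDr tscaleDl.

Lemma tproj_scalable : scalable tproj.
Proof. by move=> k s; rewrite -tscale_proj. Qed.

HB.instance Definition _ :=
  GRing.isScalable.Build K free tensor *:%R tproj tproj_scalable.

Definition tpure (u : U) (v : V) : tensor := tproj << (u, v) >>.

Lemma tpure_bilinear : bilinear_for *:%R *:%R tpure.
Proof.
split=> [v|u] k x y; rewrite /tpure.
  have -> : tproj << (k *: x + y, v) >>
      = tproj << (k *: x, v) >> + tproj << (y, v) >>.
    by rewrite -raddfD; apply/tproj_eq; rewrite opprD addrA; apply: bspan_addl.
  congr (_ + _); rewrite -linearZ; apply/tproj_eq; exact: bspan_scalel.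
have -> : tproj << (u, k *: x + y) >>
    = tproj << (u, k *: x) >> + tproj << (u, y) >>.
  by rewrite -raddfD; apply/tproj_eq; rewrite opprD addrA; apply: bspan_addr.
congr (_ + _); rewrite -linearZ; apply/tproj_eq; exact: bspan_scaler.
Qed.

HB.instance Definition _ :=
  bilinear_isBilinear.Build K U V tensor _ _ tpure tpure_bilinear.

End TensorDef.

Notation "U ⊗ V" := (tensor U V) : type_scope.
Notation "u ⊗ v" := (tpure u v) : ring_scope.

(* [tlift f] is the linear map induced by a bilinear f. It is defined for every
   function f, through a choice of representatives, so that it can be applied
   directly to an expression in two bound variables. It does not
   depend on that choice when f is bilinear, see tlift_pure and tlift_linear. *)
Section TensorLift.
Context {K : fieldType} {U V W : lmodType K}.

Definition tlift (f : U -> V -> W) (t : U ⊗ V) : W :=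
  \sum_(p <- dom (trepr t)) coeff p (trepr t) *: f p.1 p.2.

Lemma eq_tlift (f g : U -> V -> W) : f =2 g -> tlift f =1 tlift g.
Proof. by move=> fg t; apply: eq_bigr => p _; rewrite fg. Qed.

Section Bilinear.
Variable f : U -> V -> W.
Hypothesis fbil : bilinear_for *:%R *:%R f.
Local Notation lf := (fglift (fun p : U * V => f p.1 p.2)).

Let lfB : zmod_morphism lf. Proof. exact: lift_is_additive. Qed.
HB.instance Definition _ := GRing.isZmodMorphism.Build _ _ lf lfB.

Let lfUk k p : lf << k *g p >> = k *: f p.1 p.2.
Proof. exact: liftU. Qed.

Let lfU u v : lf << (u, v) >> = f u v.
Proof. by rewrite lfUk scale1r. Qed.

Let lfZ k s : lf (k *: s) = k *: lf s.
Proof.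
rewrite -[s]freeg_sumE scaler_sumr !(raddf_sum lf) scaler_sumr.
apply: eq_bigr => x _.
transitivity (lf << k * coeff x s *g x >>); last by rewrite /= !lfUk scalerA.
by congr fglift; apply/eqP/freeg_eqP => z; rewrite coeffZ !coeffU mulrA.
Qed.

Let lf_span s : bilinear_span s -> lf s = 0.
Proof.
have [fl fr] := fbil.
elim=> [|{}s t _ hs _ ht|k {}s _ hs|u u' v|u v v'|k u v|k u v].
- exact: raddf0.
- by rewrite raddfD /= hs ht addr0.
- by rewrite lfZ hs scaler0.
- have /= := fl v 1 u u'; rewrite !scale1r => fD.
  by rewrite !raddfB /= !lfU fD addrAC addrK subrr.
- have /= := fr u 1 v v'; rewrite !scale1r => fD.
  by rewrite !raddfB /= !lfU fD addrAC addrK subrr.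
- have /= f0 := fl v (-1) u u; rewrite !scaleN1r !addNr in f0.
  have /= := fl v k u 0; rewrite f0 !addr0 => fZ.
  by rewrite raddfB /= lfZ !lfU fZ subrr.
- have /= f0 := fr u (-1) v v; rewrite !scaleN1r !addNr in f0.
  have /= := fr u k v 0; rewrite f0 !addr0 => fZ.
  by rewrite raddfB /= lfZ !lfU fZ subrr.
Qed.

Let tliftE t : tlift f t = lf (trepr t).
Proof.
rewrite -[in RHS](freeg_sumE (trepr t)) (raddf_sum lf).
by apply: eq_bigr => p _; rewrite /= lfUk.
Qed.

Let tlift_proj s : tlift f (tproj s) = lf s.
Proof.
rewrite tliftE.
apply/eqP; rewrite -subr_eq0 -raddfB; apply/eqP/lf_span/tproj_eq.
exact: treprK.
Qed.

Lemma tlift_pure u v : tlift f (u ⊗ v) = f u v.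
Proof. by rewrite tlift_proj lfU. Qed.

Lemma tlift_linear : linear (tlift f).
Proof.
move=> k s t; rewrite -(treprK s) -(treprK t) -linearP !tlift_proj.
by rewrite (raddfD lf) /= lfZ.
Qed.

End Bilinear.

Section Packed.
Variable f : {bilinear U -> V -> W}.

Lemma bilinearP : bilinear_for *:%R *:%R f.
Proof. by split=> [v|u] k x y; rewrite ?linearPl ?linearPr. Qed.

HB.instance Definition _ :=
  GRing.isLinear.Build K (U ⊗ V)%type W *:%R (tlift f) (tlift_linear bilinearP).

End Packed.
End TensorLift.

(* Sweedler notation, \sw_(a1, a2 <- comul a) f a1 a2 = Σ f(a_(1), a_(2)). *)
Notation "\sw_ ( x , y <- t ) E" := (tlift (fun x y => E) t) : ring_scope.

Section SweedlerTheory.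
Context {K : fieldType}.
Implicit Types U V W X Y : lmodType K.

Definition is_bilinear U V W (f : U -> V -> W) := bilinear_for *:%R *:%R f.

Lemma tlift_fun_linear U V W (f g : U -> V -> W) k t :
  \sw_(x, y <- t) (k *: f x y + g x y)
  = k *: (\sw_(x, y <- t) f x y) + \sw_(x, y <- t) g x y.
Proof.
rewrite /tlift scaler_sumr -big_split /=; apply: eq_bigr => p _.
by rewrite scalerDr !scalerA mulrC.
Qed.

Lemma tlift_exchange U V X Y W (f : U -> V -> X -> Y -> W) s t :
  \sw_(x, y <- s) \sw_(z, w <- t) f x y z w
  = \sw_(z, w <- t) \sw_(x, y <- s) f x y z w.
Proof.
rewrite /tlift; under eq_bigr do rewrite scaler_sumr.
under [RHS]eq_bigr do rewrite scaler_sumr.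
rewrite exchange_big /=; apply: eq_bigr => p _; apply: eq_bigr => q _.
by rewrite !scalerA mulrC.
Qed.

Lemma linear_tlift U V W X (g : W -> X) (f : U -> V -> W) t :
  linear g -> g (\sw_(x, y <- t) f x y) = \sw_(x, y <- t) g (f x y).
Proof.
move=> gl; pose gL := GRing.isLinear.Build K W X *:%R g gl.
pose h : {linear W -> X} := HB.pack g gL.
rewrite -[g]/(h : W -> X) /tlift linear_sum /=.
by apply: eq_bigr => p _; exact: (linearZ_LR h).
Qed.

Lemma tlift_tpure U V (t : tensor U V) : \sw_(x, y <- t) (x ⊗ y) = t.
Proof.
rewrite -[RHS]treprK -[in RHS](freeg_sumE (trepr t)) raddf_sum.
apply: eq_bigr => -[u v] _ /=; rewrite /tpure -linearZ; congr tproj.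
by apply/eqP/freeg_eqP => z; rewrite coeffZ !coeffU mul1r.
Qed.

Lemma tlift_tlift U V X Y W (f : X -> Y -> W) (g : U -> V -> tensor X Y) t :
  is_bilinear f ->
  tlift f (\sw_(x, y <- t) g x y) = \sw_(x, y <- t) tlift f (g x y).
Proof. by move=> fb; rewrite linear_tlift //; apply: tlift_linear. Qed.

Lemma tpure_linearl U V (v : V) : linear (fun u : U => u ⊗ v).
Proof. exact: (tpure_bilinear U V).1. Qed.

Lemma tpure_linearr U V (u : U) : linear (fun v : V => u ⊗ v).
Proof. exact: (tpure_bilinear U V).2. Qed.

Lemma tensor_linear_ext U V W (g h : tensor U V -> W) :
  linear g -> linear h -> (forall u v, g (u ⊗ v) = h (u ⊗ v)) -> g =1 h.
Proof.
move=> gl hl gh t; rewrite -(tlift_tpure t).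
by rewrite (linear_tlift _ _ gl) (linear_tlift _ _ hl); apply: eq_tlift.
Qed.

End SweedlerTheory.

HB.mixin Record isCoalgebra (K : fieldType) C of GRing.Lmodule K C := {
  comul : {linear C -> (C ⊗ C)%type};
  counit : {scalar C};
  comulA : forall c : C,
    \sw_(x, y <- comul c) \sw_(x1, x2 <- comul x) (x1 ⊗ (x2 ⊗ y))
    = \sw_(x, y <- comul c) \sw_(y1, y2 <- comul y) (x ⊗ (y1 ⊗ y2));
  counitl : forall c : C, \sw_(x, y <- comul c) (counit x *: y) = c;
  counitr : forall c : C, \sw_(x, y <- comul c) (counit y *: x) = c
}.

#[short(type="coalgType")]
HB.structure Definition Coalgebra (K : fieldType) :=
  {C of isCoalgebra K C & GRing.Lmodule K C}.

Section CoassocTheory.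
Context {K : fieldType} {C : coalgType K} {W : lmodType K}.

Lemma comulA_trilinear (T : C -> C -> C -> W) (c : C) :
    (forall y z, linear (fun x => T x y z)) ->
    (forall x, is_bilinear (T x)) ->
  \sw_(x, y <- comul c) \sw_(x1, x2 <- comul x) T x1 x2 y
  = \sw_(x, y <- comul c) \sw_(y1, y2 <- comul y) T x y1 y2.
Proof.
move=> T1 T23; pose P x t := tlift (T x) t.
have Pb : is_bilinear P.
  split=> [t|x] k u v; last exact: (tlift_linear (T23 x)).
  rewrite /P /= -tlift_fun_linear; apply: eq_tlift => y z; exact: T1.
have PE x y z : tlift P (x ⊗ (y ⊗ z)) = T x y z.
  by rewrite (tlift_pure Pb) /P (tlift_pure (T23 x)).
have := congr1 (tlift P) (comulA c); rewrite !tlift_tlift // => E.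
transitivity (\sw_(x, y <- comul c)
    tlift P (\sw_(x1, x2 <- comul x) (x1 ⊗ (x2 ⊗ y)))).
  by apply: eq_tlift => x y; rewrite tlift_tlift //; apply: eq_tlift => x1 x2.
by rewrite E; apply: eq_tlift => x y; rewrite tlift_tlift //; apply: eq_tlift.
Qed.

End CoassocTheory.

(* C ⊗ D with Δ(c ⊗ d) = Σ (c_(1) ⊗ d_(1)) ⊗ (c_(2) ⊗ d_(2)) and
   ε(c ⊗ d) = ε(c) ε(d). *)
Section TensorCoalgebra.
Context {K : fieldType} (C D : coalgType K).

Definition comul_pair (c : C) (d : D) : (tensor C D) ⊗ (tensor C D) :=
  \sw_(c1, c2 <- comul c) \sw_(d1, d2 <- comul d) ((c1 ⊗ d1) ⊗ (c2 ⊗ d2)).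

Definition counit_pair (c : C) (d : D) : K^o := counit c * counit d.

Lemma comul_pair_bilinear : is_bilinear comul_pair.
Proof.
split=> [d|c] k x y; rewrite /comul_pair /=.
  rewrite linearP /=; apply: tlift_linear; split=> [c2|c1] {}k {}x {}y /=.
    rewrite -tlift_fun_linear; apply: eq_tlift => d1 d2.
    by rewrite tpure_linearl tpure_linearl.
  rewrite -tlift_fun_linear; apply: eq_tlift => d1 d2.
  by rewrite tpure_linearl tpure_linearr.
rewrite -tlift_fun_linear; apply: eq_tlift => c1 c2.
rewrite linearP /=; apply: tlift_linear; split=> [d2|d1] {}k {}x {}y /=.
  by rewrite tpure_linearr tpure_linearl.
by rewrite !tpure_linearr.
Qed.

HB.instance Definition _ := bilinear_isBilinear.Build K C D
  (tensor (tensor C D) (tensor C D)) _ _ comul_pair comul_pair_bilinear.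

Lemma counit_pair_bilinear : is_bilinear counit_pair.
Proof.
split=> [d|c] k x y; rewrite /counit_pair /= linearP /=.
  by rewrite mulrDl -mulrA.
by rewrite mulrDr mulrCA.
Qed.

Definition tensor_comul : tensor C D -> tensor (tensor C D) (tensor C D) :=
  tlift comul_pair.
Definition tensor_counit : tensor C D -> K := tlift counit_pair.

Lemma tensor_comul_linear : linear tensor_comul.
Proof. exact: (tlift_linear comul_pair_bilinear). Qed.

Lemma tensor_counit_scalar : scalar tensor_counit.
Proof. exact: (tlift_linear counit_pair_bilinear). Qed.

HB.instance Definition _ := GRing.isLinear.Build K (tensor C D)
  (tensor (tensor C D) (tensor C D)) *:%R tensor_comul tensor_comul_linear.
HB.instance Definition _ := GRing.isLinear.Build K (tensor C D)
  K *%R tensor_counit tensor_counit_scalar.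

Lemma tensor_comulE c d : tensor_comul (c ⊗ d) = comul_pair c d.
Proof. exact: (tlift_pure comul_pair_bilinear). Qed.

Lemma tensor_counitE c d : tensor_counit (c ⊗ d) = counit c * counit d.
Proof. exact: (tlift_pure counit_pair_bilinear). Qed.

Lemma tlift_comul_pair (W : lmodType K) (f : tensor C D -> tensor C D -> W) c d :
  is_bilinear f ->
  tlift f (comul_pair c d)
  = \sw_(c1, c2 <- comul c) \sw_(d1, d2 <- comul d) f (c1 ⊗ d1) (c2 ⊗ d2).
Proof.
move=> fb; rewrite /comul_pair (tlift_tlift _ _ fb); apply: eq_tlift => c1 c2.
rewrite (tlift_tlift _ _ fb); apply: eq_tlift => d1 d2; exact: tlift_pure.
Qed.

Lemma tlift_linear_comp (U W : lmodType K) (f : tensor C D -> tensor C D -> W) :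
  is_bilinear f -> linear (fun t => tlift f (tensor_comul t)).
Proof. by move=> fb k x y; rewrite linearP /= (tlift_linear fb). Qed.

Fact tensor_counitl t :
  \sw_(x, y <- tensor_comul t) (tensor_counit x *: y) = t.
Proof.
have fb : is_bilinear (fun x y : tensor C D => tensor_counit x *: y).
  split=> [y|x] k u v /=; first by rewrite linearP scalerDl scalerA.
  by rewrite scalerDr !scalerA mulrC.
move: t.
apply: (tensor_linear_ext (tlift_linear_comp C fb)) => [k x y //|c d].
rewrite tensor_comulE tlift_comul_pair //.
have bc : linear (fun x : C => x ⊗ d) by exact: tpure_linearl.
rewrite -[in RHS](counitl c) (linear_tlift _ _ bc); apply: eq_tlift => c1 c2.
rewrite -[in RHS](counitl d) (linear_tlift _ _ (tpure_linearr _)).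
apply: eq_tlift => d1 d2; rewrite tensor_counitE.
by rewrite -scalerA !linearZl /= linearZr.
Qed.

Fact tensor_counitr t :
  \sw_(x, y <- tensor_comul t) (tensor_counit y *: x) = t.
Proof.
have fb : is_bilinear (fun x y : tensor C D => tensor_counit y *: x).
  split=> [y|x] k u v /=; last by rewrite linearP scalerDl scalerA.
  by rewrite scalerDr !scalerA mulrC.
move: t.
apply: (tensor_linear_ext (tlift_linear_comp C fb)) => [k x y //|c d].
rewrite tensor_comulE tlift_comul_pair //.
have bc : linear (fun x : C => x ⊗ d) by exact: tpure_linearl.
rewrite -[in RHS](counitr c) (linear_tlift _ _ bc); apply: eq_tlift => c1 c2.
rewrite -[in RHS](counitr d) (linear_tlift _ _ (tpure_linearr _)).
apply: eq_tlift => d1 d2; rewrite tensor_counitE.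
by rewrite -scalerA !linearZl /= linearZr.
Qed.

Fact tensor_comulA t :
  \sw_(x, y <- tensor_comul t) \sw_(x1, x2 <- tensor_comul x)
    (x1 ⊗ (x2 ⊗ y))
  = \sw_(x, y <- tensor_comul t) \sw_(y1, y2 <- tensor_comul y)
    (x ⊗ (y1 ⊗ y2)).
Proof.
set W := tensor (tensor C D) (tensor (tensor C D) (tensor C D)).
have pb (y : tensor C D) : is_bilinear
    (fun x1 x2 : tensor C D => (x1 ⊗ (x2 ⊗ y)) : W).
  split=> [x2|x1] k u v /=; first exact: tpure_linearl.
  by rewrite tpure_linearl tpure_linearr.
have qb (x : tensor C D) : is_bilinear
    (fun y1 y2 : tensor C D => (x ⊗ (y1 ⊗ y2)) : W).
  split=> [y2|y1] k u v /=; first by rewrite tpure_linearl tpure_linearr.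
  by rewrite !tpure_linearr.
have fb : is_bilinear (fun x y : tensor C D =>
    \sw_(x1, x2 <- tensor_comul x) (x1 ⊗ (x2 ⊗ y)) : W).
  split=> [y|x] k u v /=; first by rewrite linearP /= (tlift_linear (pb y)).
  rewrite -tlift_fun_linear; apply: eq_tlift => x1 x2.
  by rewrite !tpure_linearr.
have gb : is_bilinear (fun x y : tensor C D =>
    \sw_(y1, y2 <- tensor_comul y) (x ⊗ (y1 ⊗ y2)) : W).
  split=> [y|x] k u v /=; last by rewrite linearP /= (tlift_linear (qb x)).
  by rewrite -tlift_fun_linear; apply: eq_tlift => y1 y2; apply: tpure_linearl.
move: t.
apply: (tensor_linear_ext (tlift_linear_comp C fb) (tlift_linear_comp C gb)) => c d.
rewrite tensor_comulE (tlift_comul_pair _ _ fb) (tlift_comul_pair _ _ gb).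
pose T c1 c2 c3 d1 d2 d3 : W := (c1 ⊗ d1) ⊗ ((c2 ⊗ d2) ⊗ (c3 ⊗ d3)).
transitivity (\sw_(d', d3 <- comul d) \sw_(d1, d2 <- comul d')
    \sw_(c', c3 <- comul c) \sw_(c1, c2 <- comul c') T c1 c2 c3 d1 d2 d3).
  rewrite tlift_exchange; apply: eq_tlift => d' d3.
  rewrite tlift_exchange; apply: eq_tlift => c' c3.
  rewrite tensor_comulE (tlift_comul_pair _ _ (pb _)).
  by rewrite tlift_exchange.
transitivity (\sw_(d', d3 <- comul d) \sw_(d1, d2 <- comul d')
    \sw_(c1, c' <- comul c) \sw_(c2, c3 <- comul c') T c1 c2 c3 d1 d2 d3).
  apply: eq_tlift => d' d3; apply: eq_tlift => d1 d2.
  apply: comulA_trilinear => [c2 c3 k u v|c1].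
    by rewrite /T !tpure_linearl.
  split=> [c3|c2] k u v; rewrite /T /=.
    by rewrite tpure_linearl tpure_linearl tpure_linearr.
  by rewrite tpure_linearl !tpure_linearr.
transitivity (\sw_(d', d3 <- comul d) \sw_(c1, c' <- comul c)
    \sw_(d1, d2 <- comul d') \sw_(c2, c3 <- comul c') T c1 c2 c3 d1 d2 d3).
  by apply: eq_tlift => d' d3; rewrite tlift_exchange.
rewrite tlift_exchange; apply: eq_tlift => c1 c'.
transitivity (\sw_(c2, c3 <- comul c') \sw_(d', d3 <- comul d)
    \sw_(d1, d2 <- comul d') T c1 c2 c3 d1 d2 d3).
  by rewrite tlift_exchange; apply: eq_tlift => d' d3; rewrite tlift_exchange.
transitivity (\sw_(c2, c3 <- comul c') \sw_(d1, d' <- comul d)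
    \sw_(d2, d3 <- comul d') T c1 c2 c3 d1 d2 d3).
  apply: eq_tlift => c2 c3.
  apply: (comulA_trilinear (T := T c1 c2 c3)) => [d2 d3 k u v|d1].
    by rewrite /T tpure_linearr tpure_linearl.
  split=> [d3|d2] k u v; rewrite /T /=.
    by rewrite tpure_linearr tpure_linearl tpure_linearr.
  by rewrite !tpure_linearr.
rewrite tlift_exchange; apply: eq_tlift => d1 d'.
by rewrite tensor_comulE (tlift_comul_pair _ _ (qb _)).
Qed.

HB.instance Definition _ := isCoalgebra.Build K (tensor C D)
  tensor_comulA tensor_counitl tensor_counitr.

End TensorCoalgebra.

(* Morphisms of coalgebras, (f ⊗ f) Δ = Δ f and ε f = ε. *)
Definition coalgebra_morphism (K : fieldType) (C D : coalgType K)
    (f : {linear C -> D}) : Prop :=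
  (forall c, comul (f c) = \sw_(x, y <- comul c) (f x ⊗ f y)) /\
  (forall c, counit (f c) = counit c).

Section MulBilinear.
Context {K : fieldType} (A : algType K).

Definition mulb (a b : A) : A := a * b.

Lemma mulb_bilinear : is_bilinear mulb.
Proof.
split=> [b|a] k x y; rewrite /mulb.
  by rewrite mulrDl -scalerAl.
by rewrite mulrDr -scalerAr.
Qed.

HB.instance Definition _ :=
  bilinear_isBilinear.Build K A A A _ _ mulb mulb_bilinear.

End MulBilinear.

(* The product * of the algType A is the operation ◇ and 1 is 1_◇. The library's
   requirement 1 != 0 on algebras is no restriction here, because ε(1) = 1. *)
#[short(type="algCoalgType")]
HB.structure Definition AlgCoalgebra (K : fieldType) :=
  {A of GRing.Algebra K A & Coalgebra K A}.

HB.mixin Record isBialgebra (K : fieldType) A of AlgCoalgebra K A := {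
  mul_coalgebra_morphism : coalgebra_morphism (tlift (@mulb K A));
  comul1 : comul (1 : A) = 1 ⊗ 1;
  counit1 : counit (1 : A) = 1
}.

#[short(type="bialgType")]
HB.structure Definition Bialgebra (K : fieldType) :=
  {A of isBialgebra K A & AlgCoalgebra K A}.

HB.mixin Record isHopfAlgebra (K : fieldType) A of Bialgebra K A := {
  antipode : {linear A -> A};
  antipodel : forall a : A,
    \sw_(a1, a2 <- comul a) (antipode a1 * a2) = counit a *: 1;
  antipoder : forall a : A,
    \sw_(a1, a2 <- comul a) (a1 * antipode a2) = counit a *: 1
}.

#[short(type="hopfAlgType")]
HB.structure Definition HopfAlgebra (K : fieldType) :=
  {A of isHopfAlgebra K A & Bialgebra K A}.

HB.mixin Record isNonunitalBialgebra (K : fieldType) A of Coalgebra K A := {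
  circ : {bilinear A -> A -> A};
  circA : associative circ;
  circ_coalgebra_morphism : coalgebra_morphism (tlift circ)
}.

#[short(type="nonunitalBialgType")]
HB.structure Definition NonunitalBialgebra (K : fieldType) :=
  {A of isNonunitalBialgebra K A & Coalgebra K A}.

Notation "a ∘ b" := (circ a b) : ring_scope.

#[short(type="hopfNonunitalBialgType")]
HB.structure Definition HopfNonunitalBialgebra (K : fieldType) :=
  {A of HopfAlgebra K A & NonunitalBialgebra K A}.

HB.mixin Record isHopfTruss (K : fieldType) A of HopfNonunitalBialgebra K A := {
  sigma : {linear A -> A};
  sigma_coalgebra_morphism : coalgebra_morphism sigma;
  truss_distr : forall a b c : A,
    a ∘ (b * c)
    = \sw_(a1, a' <- comul a) \sw_(a2, a3 <- comul a')
        ((a1 ∘ b) * antipode (sigma a2) * (a3 ∘ c))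
}.

#[short(type="hopfTrussType")]
HB.structure Definition HopfTruss (K : fieldType) :=
  {A of isHopfTruss K A & HopfNonunitalBialgebra K A}.

Record left_module_algebra (K : fieldType) (H : nonunitalBialgType K)
    (R : algType K) (act : H -> R -> R) : Prop := LeftModuleAlgebra {
  act_bilinear : is_bilinear act;
  actM : forall a b c,
    act a (b * c) = \sw_(a1, a2 <- comul a) (act a1 b * act a2 c);
  act1 : forall a, act a 1 = counit a *: 1;
  act_circ : forall a b c, act (a ∘ b) c = act a (act b c)
}.

Section TrussActions.
Context {K : fieldType} {A : hopfTrussType K}.

Definition triangler (a b : A) : A :=
  \sw_(a1, a2 <- comul a) (antipode (sigma a1) * (a2 ∘ b)).

Definition btriangler (a b : A) : A :=
  \sw_(a1, a2 <- comul a) ((a1 ∘ b) * antipode (sigma a2)).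

End TrussActions.

Notation "a ▷ b" := (triangler a b) : ring_scope.
Notation "a ▶ b" := (btriangler a b) : ring_scope.

(* Main.v *)
(* In the convolution algebra Hom(A, A), write r_b for a |-> a ∘ b and s for
   S σ, which is the inverse of σ. The truss law reads r_(bc) = r_b s r_c. The
   coalgebra map r_1 is invertible, so r_1 = r_1 s r_1 gives s = r_1^-1, hence
   σ = r_1, and σ(a ∘ b) = a ∘ σ(b) by associativity of ∘. Since
   (- ▷ b) = s r_b and (- ▶ b) = r_b s, all claims but the compatibility of the
   actions with ∘ are then immediate. For that one, (a, b) |-> S σ(a ∘ b) is
   the convolution inverse of (a, b) |-> σ(a ∘ b) in Hom(A ⊗ A, A), and part (2)
   lets one compute this inverse: S σ(a ∘ b) = Σ (a_(1) ▷ S σ(b)) S σ(a_(2)),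
   and S σ(a ∘ b) = Σ S σ(a_(1)) (a_(2) ▶ S σ(b)). *)
Require Import Defs.
From HB Require Import structures.
From mathcomp Require Import all_boot all_algebra.
From mathcomp Require Import boolp.
Import GRing.Theory.
Local Open Scope ring_scope.
Set Implicit Arguments.
Unset Strict Implicit.

(** * Convolution algebra Hom(C, A) of a coalgebra and an algebra *)

Section Convolution.
Context {K : fieldType} {C : coalgType K} {A : algType K}.

(** Taken for arbitrary functions, like [tlift]; linearity of both makes it independent of the
    chosen representatives. *)
Definition conv (f g : C -> A) (c : C) : A :=
  \sw_(x, y <- comul c) (f x * g y).

Definition conv1 (c : C) : A := counit c *: 1.

Lemma conv1_linear : linear conv1.
Proof. by move=> k x y; rewrite /conv1 linearP scalerDl scalerA. Qed.

HB.instance Definition _ := GRing.isLinear.Build K C A *:%R conv1 conv1_linear.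

Lemma mul_bilinear (D : lmodType K) (f : {linear C -> A}) (g : {linear D -> A}) :
  is_bilinear (fun x y => f x * g y).
Proof.
split=> [y|x] k u v; rewrite linearP /=.
  by rewrite mulrDl scalerAl.
by rewrite mulrDr scalerAr.
Qed.

Lemma conv_linear (f g : {linear C -> A}) : linear (conv f g).
Proof.
move=> k x y; rewrite /conv linearP.
exact: (tlift_linear (mul_bilinear f g)).
Qed.

HB.instance Definition _ (f g : {linear C -> A}) :=
  GRing.isLinear.Build K C A *:%R (conv f g) (conv_linear f g).

Lemma mulr_tlift (U V : lmodType K) (F : U -> V -> A) t a :
  (\sw_(x, y <- t) F x y) * a = \sw_(x, y <- t) (F x y * a).
Proof. exact: (linear_tlift F t ((mulb_bilinear A).1 a)). Qed.

Lemma mull_tlift (U V : lmodType K) (F : U -> V -> A) t a :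
  a * (\sw_(x, y <- t) F x y) = \sw_(x, y <- t) (a * F x y).
Proof. exact: (linear_tlift F t ((mulb_bilinear A).2 a)). Qed.

Lemma convA (f g h : {linear C -> A}) :
  conv f (conv g h) = conv (conv f g) h.
Proof.
apply/funext => c; rewrite /conv.
under eq_tlift do rewrite mull_tlift.
under [RHS]eq_tlift do rewrite mulr_tlift.
rewrite (comulA_trilinear (T := fun x y z => f x * g y * h z)).
- by apply: eq_tlift => x y; apply: eq_tlift => z t; rewrite mulrA.
- by move=> y z k u v; rewrite linearP !mulrDl -!scalerAl.
- move=> x; split=> [z|y] k u v; rewrite linearP /=.
    by rewrite mulrDr mulrDl -scalerAr -scalerAl.
  by rewrite mulrDr -scalerAr.
Qed.

Lemma conv1f (f : {linear C -> A}) : conv conv1 f = f.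
Proof.
apply/funext => c; rewrite -[in RHS](counitl c) linear_tlift; last exact: linearP.
by apply: eq_tlift => x y; rewrite /conv1 linearZ -scalerAl mul1r.
Qed.

Lemma convf1 (f : {linear C -> A}) : conv f conv1 = f.
Proof.
apply/funext => c; rewrite -[in RHS](counitr c) linear_tlift; last exact: linearP.
by apply: eq_tlift => x y; rewrite /conv1 linearZ -scalerAr mulr1.
Qed.

(** A left inverse equals a right inverse: [g = g (f h) = (g f) h = h]. *)
Lemma conv_inv_uniq (f g h : {linear C -> A}) :
  conv g f = conv1 -> conv f h = conv1 -> (g : _ -> _) = h.
Proof. by move=> gf fh; rewrite -[LHS]convf1 -fh convA gf conv1f. Qed.

End Convolution.

(** * Pullback of convolution along a coalgebra morphism *)

Section ConvolutionMorphism.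
Context {K : fieldType} {C D : coalgType K} (phi : {linear C -> D}).
Hypothesis phiM : coalgebra_morphism phi.

Lemma conv_comp (A : algType K) (f g : {linear D -> A}) :
  conv f g \o phi = conv (f \o phi) (g \o phi).
Proof.
apply/funext => c; rewrite /= /conv phiM.1 tlift_tlift; last exact: mul_bilinear.
by apply: eq_tlift => x y; rewrite tlift_pure //; apply: mul_bilinear.
Qed.

Lemma conv1_comp (A : algType K) : conv1 \o phi = conv1 :> (C -> A).
Proof. by apply/funext => c; rewrite /= /conv1 phiM.2. Qed.

End ConvolutionMorphism.

(** * Convolution inverse of a coalgebra morphism into a Hopf algebra *)

Section ConvolutionAntipode.
Context {K : fieldType} {C : coalgType K} {A : hopfAlgType K}.
Variable phi : {linear C -> A}.
Hypothesis phiM : coalgebra_morphism phi.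

Lemma conv_antipodel : conv (antipode \o phi) phi = conv1.
Proof.
(* Reading [phi] as [idfun \o phi] makes this the pullback along [phi] of the antipode law in Hom(A,
   A). *)
rewrite -(conv1_comp phiM) -[LHS]/(conv (antipode \o phi) (idfun \o phi)).
rewrite -(conv_comp phiM antipode idfun); congr (_ \o _).
by apply/funext => a; rewrite /conv antipodel.
Qed.

Lemma conv_antipoder : conv phi (antipode \o phi) = conv1.
Proof.
rewrite -(conv1_comp phiM) -[LHS]/(conv (idfun \o phi) (antipode \o phi)).
rewrite -(conv_comp phiM idfun antipode); congr (_ \o _).
by apply/funext => a; rewrite /conv antipoder.
Qed.

End ConvolutionAntipode.

(** * Convolution on a tensor product of coalgebras *)

Section TensorConvolution.
Context {K : fieldType} {C D : coalgType K} {A : algType K}.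

Lemma conv_tensorE (F G : {linear (C ⊗ D)%type -> A}) c d :
  conv F G (c ⊗ d) = \sw_(c1, c2 <- comul c) \sw_(d1, d2 <- comul d)
    (F (c1 ⊗ d1) * G (c2 ⊗ d2)).
Proof.
rewrite /conv [comul _]tensor_comulE tlift_comul_pair //.
exact: mul_bilinear.
Qed.

Lemma conv1_tensorE (c : C) (d : D) :
  conv1 (c ⊗ d) = (counit c * counit d) *: 1 :> A.
Proof. by rewrite /conv1 [counit _]tensor_counitE. Qed.

(** This is [f ⊗ ε] in curried form; [tlift] makes it a map on C ⊗ D that can be convolved with
    others. *)
Definition counitr_ext (f : C -> A) (c : C) (d : D) : A := counit d *: f c.

Lemma counitr_ext_bilinear (f : {linear C -> A}) : is_bilinear (counitr_ext f).
Proof.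
split=> [d|c] k u v; rewrite /counitr_ext linearP /=.
  by rewrite scalerDr !scalerA mulrC.
by rewrite scalerDl scalerA.
Qed.

HB.instance Definition _ (f : {linear C -> A}) := bilinear_isBilinear.Build K
  C D A _ _ (counitr_ext f) (counitr_ext_bilinear f).

Lemma tlift_counitr_ext (f : {linear C -> A}) c d :
  tlift (counitr_ext f) (c ⊗ d) = counit d *: f c.
Proof. exact: (tlift_pure (counitr_ext_bilinear f)). Qed.

(** The factor [counit d1] absorbs the coproduct of [d] by the counit law, leaving only the sum over
    [c]. *)
Lemma conv_counitr_extl (f : {linear C -> A})
    (G : {linear (C ⊗ D)%type -> A}) c d :
  conv (tlift (counitr_ext f)) G (c ⊗ d)
  = \sw_(c1, c2 <- comul c) (f c1 * G (c2 ⊗ d)).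
Proof.
rewrite conv_tensorE /=; apply: eq_tlift => c1 c2.
rewrite -[in RHS](counitl d) (linear_tlift _ _ (tpure_linearr _)).
rewrite linear_tlift; last exact: linearP.
rewrite mull_tlift; apply: eq_tlift => d1 d2.
by rewrite tlift_counitr_ext linearZr linearZ -scalerAr -scalerAl.
Qed.

Lemma conv_counitr_extr (f : {linear C -> A})
    (G : {linear (C ⊗ D)%type -> A}) c d :
  conv G (tlift (counitr_ext f)) (c ⊗ d)
  = \sw_(c1, c2 <- comul c) (G (c1 ⊗ d) * f c2).
Proof.
rewrite conv_tensorE /=; apply: eq_tlift => c1 c2.
rewrite -[in RHS](counitr d) (linear_tlift _ _ (tpure_linearr _)).
rewrite linear_tlift; last exact: linearP.
rewrite mulr_tlift; apply: eq_tlift => d1 d2.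
by rewrite tlift_counitr_ext linearZr linearZ -scalerAr -scalerAl.
Qed.

Lemma conv_counitr_ext (f g : {linear C -> A}) :
  conv f g = conv1 ->
  conv (tlift (counitr_ext f)) (tlift (counitr_ext g))
  = (conv1 : (C ⊗ D)%type -> A).
Proof.
move=> fg; apply/funext; apply: tensor_linear_ext => [k x y|k x y|c d].
- by rewrite linearP.
- by rewrite linearP.
rewrite conv_counitr_extl conv1_tensorE mulrC.
rewrite -scalerA -[_ *: 1]/(conv1 c) -fg.
transitivity (\sw_(x, y <- comul c) (counit d *: (f x * g y))).
  apply: eq_tlift => x y /=.
  by rewrite tlift_counitr_ext -scalerAr.
by rewrite -(linear_tlift _ _ (g := *:%R (counit d))) // => k u v;
  rewrite linearP.
Qed.

End TensorConvolution.

(** * Convolution of maps twisted by an action *)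

Section ActionConvolution.
Context {K : fieldType} {C D : coalgType K} {A : algType K}.
Variable act : {bilinear C -> A -> A}.

Definition act_ext (f : D -> A) (c : C) (d : D) : A := act c (f d).

Lemma act_ext_bilinear (f : {linear D -> A}) : is_bilinear (act_ext f).
Proof.
by split=> [d|c] k u v; rewrite /act_ext ?linearPl // linearP linearPr.
Qed.

HB.instance Definition _ (f : {linear D -> A}) := bilinear_isBilinear.Build K
  C D A _ _ (act_ext f) (act_ext_bilinear f).

Lemma tlift_act_ext (f : {linear D -> A}) c d :
  tlift (act_ext f) (c ⊗ d) = act c (f d).
Proof. exact: (tlift_pure (act_ext_bilinear f)). Qed.

Lemma act_ext_conv1 : (forall c, act c 1 = counit c *: 1) ->
  tlift (act_ext conv1) = conv1.
Proof.
move=> act1; apply/funext; apply: tensor_linear_ext => [k x y|k x y|c d].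
- by rewrite linearP.
- by rewrite linearP.
by rewrite tlift_act_ext conv1_tensorE linearZr /= act1 scalerA mulrC.
Qed.

(** With [act_ext_conv1], this lets convolution inverses pass through a module algebra action. The
    sums over [c] and [d] are swapped so that multiplicativity of [act] collapses the one over
    [c]. *)
Lemma conv_act_ext (f g : {linear D -> A}) :
  (forall c x y, act c (x * y) = \sw_(c1, c2 <- comul c) (act c1 x * act c2 y)) ->
  conv (tlift (act_ext f)) (tlift (act_ext g)) = tlift (act_ext (conv f g)).
Proof.
move=> actM; apply/funext; apply: tensor_linear_ext => [k x y|k x y|c d].
- by rewrite linearP.
- by rewrite linearP.
rewrite conv_tensorE tlift_exchange tlift_act_ext /conv /=.
rewrite [RHS]linear_tlift; last by move=> k u v; rewrite linearPr.
apply: eq_tlift => d1 d2; rewrite actM; apply: eq_tlift => c1 c2.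
by rewrite !tlift_act_ext.
Qed.

End ActionConvolution.

(** * Coproduct and counit of a product [a ∘ b] *)

Section NonunitalBialgebraTheory.
Context {K : fieldType} {H : nonunitalBialgType K}.
Implicit Types a b : H.

Lemma tlift_circ a b : tlift circ (a ⊗ b) = a ∘ b.
Proof. exact: (tlift_pure (bilinearP circ)). Qed.

Lemma comul_circ a b : comul (a ∘ b)
  = \sw_(a1, a2 <- comul a) \sw_(b1, b2 <- comul b) ((a1 ∘ b1) ⊗ (a2 ∘ b2)).
Proof.
rewrite -tlift_circ (proj1 circ_coalgebra_morphism) [comul _]tensor_comulE.
rewrite tlift_comul_pair.
  apply: eq_tlift => a1 a2; apply: eq_tlift => b1 b2.
  by rewrite /= !tlift_circ.
split=> [y|x] k u v; rewrite linearP /=.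
  exact: tpure_linearl.
exact: tpure_linearr.
Qed.

Lemma counit_circ a b : counit (a ∘ b) = counit a * counit b.
Proof.
by rewrite -tlift_circ (proj2 circ_coalgebra_morphism) [counit _]tensor_counitE.
Qed.

Lemma conv_circ (B : algType K) (f g : {linear H -> B}) :
  conv f g \o tlift circ = conv (f \o tlift circ) (g \o tlift circ).
Proof. exact: (conv_comp circ_coalgebra_morphism). Qed.

End NonunitalBialgebraTheory.

(** * Hopf trusses: [σ] and the two actions *)

Section HopfTrussTheory.
Context {K : fieldType} {A : hopfTrussType K}.
Implicit Types a b c : A.

Definition rcirc b a : A := a ∘ b.

Lemma rcirc_linear b : linear (rcirc b).
Proof. by move=> k x y; rewrite /rcirc linearPl. Qed.

HB.instance Definition _ b :=
  GRing.isLinear.Build K A A *:%R (rcirc b) (rcirc_linear b).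

Definition antisigma : A -> A := antipode \o sigma.

HB.instance Definition _ := GRing.Linear.on antisigma.

(** Convertible to [triangler] with swapped arguments, so identities in Hom(A, A) evaluate to
    identities about the action. *)
Definition rtriangle b : A -> A := conv antisigma (rcirc b).
Definition rbtriangle b : A -> A := conv (rcirc b) antisigma.

HB.instance Definition _ b := GRing.Linear.on (rtriangle b).
HB.instance Definition _ b := GRing.Linear.on (rbtriangle b).

Lemma conv_antisigma_sigma : conv antisigma sigma = conv1.
Proof. exact: (conv_antipodel (@sigma_coalgebra_morphism K A)). Qed.

Lemma conv_sigma_antisigma : conv sigma antisigma = conv1.
Proof. exact: (conv_antipoder (@sigma_coalgebra_morphism K A)). Qed.

Lemma rcircM b c :
  rcirc (b * c) = conv (conv (rcirc b) antisigma) (rcirc c).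
Proof.
(* The truss law splits the second tensor factor again, hence the regrouping to the right. *)
rewrite -convA; apply/funext => a; rewrite /rcirc truss_distr.
apply: eq_tlift => a1 a'; rewrite mull_tlift; apply: eq_tlift => a2 a3.
by rewrite mulrA.
Qed.

(** Holds because [1] is group-like and [∘] is a coalgebra map. *)
Lemma rcirc1_morphism : coalgebra_morphism (rcirc 1).
Proof.
split=> a; rewrite /= /rcirc; last by rewrite counit_circ counit1 mulr1.
rewrite comul_circ; apply: eq_tlift => a1 a2; rewrite comul1 tlift_pure //.
split=> [y|x] k u v /=.
  by rewrite linearPr tpure_linearl.
by rewrite linearPr tpure_linearr.
Qed.

Lemma sigmaE a : sigma a = a ∘ 1.
Proof.
have r1 := rcirc1_morphism.
have E : conv antisigma (rcirc 1) = conv1.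
  (* Multiplying on the left by [1 = (S r_1) r_1] leaves [r_1 s r_1 = r_1], the truss law at
     [b = c = 1]. *)
  rewrite -[LHS]conv1f -(conv_antipodel r1) -!convA; congr (conv _ _).
  by rewrite convA -rcircM mulr1.
rewrite -[RHS]/(rcirc 1 a); congr (_ a).
exact: conv_inv_uniq conv_sigma_antisigma E.
Qed.

Lemma sigma_circ a b : sigma (a ∘ b) = a ∘ sigma b.
Proof. by rewrite !sigmaE circA. Qed.

Lemma conv_sigma_rtriangle b : conv sigma (rtriangle b) = rcirc b.
Proof. by rewrite /rtriangle convA conv_sigma_antisigma conv1f. Qed.

Lemma conv_rbtriangle_sigma b : conv (rbtriangle b) sigma = rcirc b.
Proof. by rewrite /rbtriangle -convA conv_antisigma_sigma convf1. Qed.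

Lemma rtriangle1 : rtriangle 1 = conv1.
Proof.
rewrite /rtriangle -conv_antisigma_sigma; congr conv.
by apply/funext=> a; rewrite sigmaE.
Qed.

Lemma rbtriangle1 : rbtriangle 1 = conv1.
Proof.
rewrite /rbtriangle -conv_sigma_antisigma; congr conv.
by apply/funext=> a; rewrite sigmaE.
Qed.

(** Prefixing the truss law with [s] gives [(s r_b) (s r_c)]; appending [s] instead gives the mirror
    statement for [▶]. *)
Lemma rtriangleM b c : rtriangle (b * c) = conv (rtriangle b) (rtriangle c).
Proof. by rewrite /rtriangle rcircM !convA. Qed.

Lemma rbtriangleM b c : rbtriangle (b * c) = conv (rbtriangle b) (rbtriangle c).
Proof. by rewrite /rbtriangle rcircM !convA. Qed.

Lemma triangler_bilinear : is_bilinear (@triangler K A).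
Proof.
split=> [b|a] k u v; first exact: (linearP (rtriangle b)).
rewrite -tlift_fun_linear; apply: eq_tlift => x y.
by rewrite linearPr mulrDr scalerAr.
Qed.

Lemma btriangler_bilinear : is_bilinear (@btriangler K A).
Proof.
split=> [b|a] k u v; first exact: (linearP (rbtriangle b)).
rewrite -tlift_fun_linear; apply: eq_tlift => x y.
by rewrite linearPr mulrDl scalerAl.
Qed.

HB.instance Definition _ := bilinear_isBilinear.Build K A A A _ _
  (@triangler K A) triangler_bilinear.
HB.instance Definition _ := bilinear_isBilinear.Build K A A A _ _
  (@btriangler K A) btriangler_bilinear.

Lemma triangler1 a : a ▷ 1 = counit a *: 1.
Proof. exact: (congr1 (@^~ a) rtriangle1). Qed.

Lemma btriangler1 a : a ▶ 1 = counit a *: 1.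
Proof. exact: (congr1 (@^~ a) rbtriangle1). Qed.

Lemma trianglerM a b c :
  a ▷ (b * c) = \sw_(a1, a2 <- comul a) ((a1 ▷ b) * (a2 ▷ c)).
Proof. exact: (congr1 (@^~ a) (rtriangleM b c)). Qed.

Lemma btrianglerM a b c :
  a ▶ (b * c) = \sw_(a1, a2 <- comul a) ((a1 ▶ b) * (a2 ▶ c)).
Proof. exact: (congr1 (@^~ a) (rbtriangleM b c)). Qed.

(** * Compatibility of the actions with [∘], computed in Hom(A ⊗ A, A) *)

Let m : {linear (A ⊗ A)%type -> A} := tlift circ.
Let ext (f : A -> A) : (A ⊗ A)%type -> A := tlift (counitr_ext f).
HB.instance Definition _ (f : {linear A -> A}) := GRing.Linear.on (ext f).

(** Part (2) as a factorization in Hom(A ⊗ A, A), whose two factors can be inverted separately. *)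
Lemma sigma_circ_triangler :
  sigma \o m = conv (ext sigma) (tlift (act_ext (@triangler K A) sigma)).
Proof.
apply/funext; apply: tensor_linear_ext => [k x y|k x y|a b].
- by rewrite linearP.
- by rewrite linearP.
rewrite conv_counitr_extl /= tlift_circ sigma_circ.
rewrite -[LHS]/(rcirc _ a) -conv_sigma_rtriangle.
by apply: eq_tlift => a1 a2; rewrite tlift_act_ext.
Qed.

Lemma sigma_circ_btriangler :
  sigma \o m = conv (tlift (act_ext (@btriangler K A) sigma)) (ext sigma).
Proof.
apply/funext; apply: tensor_linear_ext => [k x y|k x y|a b].
- by rewrite linearP.
- by rewrite linearP.
rewrite conv_counitr_extr /= tlift_circ sigma_circ.
rewrite -[LHS]/(rcirc _ a) -conv_rbtriangle_sigma.
by apply: eq_tlift => a1 a2; rewrite tlift_act_ext.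
Qed.

Lemma conv_antisigma_sigma_circ : conv (antisigma \o m) (sigma \o m) = conv1.
Proof.
rewrite -(conv_circ antisigma sigma) conv_antisigma_sigma.
exact: (conv1_comp circ_coalgebra_morphism).
Qed.

(** The inverses of the two factors of [sigma \o m], multiplied in reverse order. *)
Lemma antisigma_circ_triangler :
  antisigma \o m
  = conv (tlift (act_ext (@triangler K A) antisigma)) (ext antisigma).
Proof.
apply: (conv_inv_uniq conv_antisigma_sigma_circ).
(* The two middle factors, both twisted by the action, cancel first; the outer ones follow. *)
rewrite /= sigma_circ_triangler -convA [X in conv _ X]convA.
rewrite conv_act_ext; last exact: trianglerM.
rewrite conv_sigma_antisigma act_ext_conv1 ?conv1f; last exact: triangler1.
exact: conv_counitr_ext conv_sigma_antisigma.
Qed.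

Lemma antisigma_circ_btriangler :
  antisigma \o m
  = conv (ext antisigma) (tlift (act_ext (@btriangler K A) antisigma)).
Proof.
apply: (conv_inv_uniq conv_antisigma_sigma_circ).
rewrite /= sigma_circ_btriangler -convA [X in conv _ X]convA.
rewrite (conv_counitr_ext conv_sigma_antisigma) conv1f.
rewrite conv_act_ext; last exact: btrianglerM.
rewrite conv_sigma_antisigma act_ext_conv1 //; exact: btriangler1.
Qed.

Lemma triangler_circ a b c : (a ∘ b) ▷ c = a ▷ (b ▷ c).
Proof.
rewrite -[LHS]/(rtriangle c _) -tlift_circ.
rewrite -[LHS]/((conv antisigma (rcirc c) \o m) (a ⊗ b)) conv_circ.
rewrite antisigma_circ_triangler -convA.
(* At [x ⊗ y] the left side is [Σ s(x_(1)) ((x_(2) ∘ y) ∘ c)], which associativity of [∘] turns into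
   [x ▷ (y ∘ c)]. *)
have -> : conv (ext antisigma) (rcirc c \o m)
    = tlift (act_ext (@triangler K A) (rcirc c)).
  apply/funext; apply: tensor_linear_ext => [k x y|k x y|x y].
  - by rewrite linearP.
  - by rewrite linearP.
  rewrite conv_counitr_extl tlift_act_ext; apply: eq_tlift => x1 x2 /=.
  by rewrite tlift_circ /rcirc circA.
(* The two remaining factors merge into [a ▷ (s r_c)(b)], and [(s r_c)(b)] is [b ▷ c]. *)
by rewrite conv_act_ext ?tlift_act_ext //; apply: trianglerM.
Qed.

(** Mirror image: [rcirc c \o m] now stands left of [ext antisigma], and together they give
    [x ▶ (y ∘ c)]. *)
Lemma btriangler_circ a b c : (a ∘ b) ▶ c = a ▶ (b ▶ c).
Proof.
rewrite -[LHS]/(rbtriangle c _) -tlift_circ.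
rewrite -[LHS]/((conv (rcirc c) antisigma \o m) (a ⊗ b)) conv_circ.
rewrite antisigma_circ_btriangler convA.
have -> : conv (rcirc c \o m) (ext antisigma)
    = tlift (act_ext (@btriangler K A) (rcirc c)).
  apply/funext; apply: tensor_linear_ext => [k x y|k x y|x y].
  - by rewrite linearP.
  - by rewrite linearP.
  rewrite conv_counitr_extr tlift_act_ext; apply: eq_tlift => x1 x2 /=.
  by rewrite tlift_circ /rcirc circA.
by rewrite conv_act_ext ?tlift_act_ext //; apply: btrianglerM.
Qed.

End HopfTrussTheory.

Theorem theorem6p5 (K : fieldType) (A : hopfTrussType K) :
  (left_module_algebra (fun a b : A => a ▷ b) /\
   left_module_algebra (fun a b : A => a ▶ b)) /\
  (forall a b : A,
     sigma (a ∘ b) = \sw_(a1, a2 <- comul a) (sigma a1 * (a2 ▷ sigma b)) /\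
     sigma (a ∘ b) = \sw_(a1, a2 <- comul a) ((a1 ▶ sigma b) * sigma a2)).
Proof.
split; [split; split|].
- exact: triangler_bilinear.
- exact: trianglerM.
- exact: triangler1.
- exact: triangler_circ.
- exact: btriangler_bilinear.
- exact: btrianglerM.
- exact: btriangler1.
- exact: btriangler_circ.
(* Once [sigma] has moved onto [b], both formulas are factorizations of [rcirc (sigma b)] evaluated
   at [a]. *)
move=> a b; rewrite sigma_circ; split.
  by rewrite -[LHS]/(rcirc _ a) -conv_sigma_rtriangle.
by rewrite -[LHS]/(rcirc _ a) -conv_rbtriangle_sigma.
Qed.
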